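(* Fix an integer $d\geq 2$, and let $M_d(k)$ denote the number of vertices of the tree $\xi_d(k)$. Then \[N_{d\text{-ary}}^{\mathrm{non}}(k)\leq M_d(k)=k^{\frac{1}{2}\log_2(k)(1+o(1))},\] where the inequality holds for all $k\geq 1$ and the $o(1)$ term tends to $0$ as $k\to\infty$ (with $d$ fixed).
   Context: Let $d\geq 2$ be an integer. A $d$-ary plane tree is either an empty tree or a root vertex with $d$ subtrees that are linearly ordered from left to right and are themselves $d$-ary plane trees (the subtrees of a vertex may be empty). The $i$-th subtree of a vertex is the $i$-th from the left; an edge has type $i$ if it connects a vertex to the root of its $i$-th subtree. The root has depth $0$; a nonroot vertex has depth $r$ if its parent has depth $r-1$. Noncontiguous containment. For a vertex $u$, let $\chi(u)$ be the set of $i\in\{1,\dots,d\}$ such that the $i$-th subtree of $u$ is nonempty. Let $e$ be an edge of type $i$ connecting $u$ to its child $v$. Contracting $e$ (merging $v$ into $u$, all other edges keeping their types, so that the merged vertex has nonempty subtrees in the positions $(\chi(u)\setminus\{i\})\cup\chi(v)$) is a legal contraction if every element of $\chi(u)\setminus\{i\}$ that is smaller than $i$ is strictly smaller than $\min(\chi(v))$ and every element of $\chi(u)\setminus\{i\}$ that is greater than $i$ is strictly greater than $\max(\chi(v))$; this condition is vacuous if $v$ is a leaf. A $d$-ary plane tree $\mathcal T$ noncontiguously contains a $d$-ary plane tree $T$ if $T$ can be obtained from $\mathcal T$ by a (possibly empty) sequence of legal edge contractions. $N_{d\text{-ary}}^{\mathrm{non}}(k)$ denotes the minimum number of vertices in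 a $d$-ary plane tree that noncontiguously contains every $d$-ary plane tree with $k$ vertices. Gluing. To glue a tree $T'$ to a vertex $v$ of a tree $T$ means to attach $T'$ to $T$ by identifying the root of $T'$ with $v$ (edge types being kept). Building blocks. The $d$-crescent is the path on $d+1$ vertices in which, for $1\le i\le d$, the vertex at depth $i$ is connected to its parent by an edge of type $i$. The $d$-vertebra $V_d$ is obtained from three copies of the $d$-crescent: remove the lowest vertex from the first copy and glue the remaining tree (a path with edge types $1,\dots,d-1$) to the vertex of depth $1$ in the second copy; then remove the root from the third copy and glue the remaining tree (a path with edge types $2,\dots,d$) to the root of the second copy. $V_d$ has exactly three leaves: the left leaf (the bottom of the first copy), the center leaf (the bottom of the second copy), and the right leaf (the bottom of the third copy). For $m\geq 1$, the $m$-th $d$-spine is obtained by consecutively gluing $m$ copies of $V_d$ under a single $d$-crescent: the first $V_d$ is glued to the leaf of the $d$-crescent, and each subsequent $V_d$ is glued to the center leaf of the previous $V_d$. The vertebrae are numbered first, second, etc., from the top down. The trees $\xi_d(k)$. $\xi_d(1)$ is a single vertex; $\xi_d(2)$ is the $d$-crescent; $\xi_d(3)$ is obtained from a $d$-crescent by giving its leaf $d$ children (one in each position). If $d=2$ and $k\geq 4$, then $\xi_2(k)$ is obtained from the $(\lfloor k/2\rfloor-1)$-th $2$-spine as follows: (1) for each $1\leq i\leq\lfloor k/2\rfloor-2$, glue a copy of $\xi_2(i)$ to each of the left and right leaves of the $i$-th $2$-vertebra; (2) glue a copy of $\xi_2(\lfloor k/2\rfloor-1)$ to the right leaf of the $(\lfloor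 k/2\rfloor-1)$-th (lowest) $2$-vertebra; (3) glue a copy of $\xi_2(\lceil k/2\rceil-1)$ to the left leaf of the $(\lfloor k/2\rfloor-1)$-th $2$-vertebra; (4) glue a copy of $\xi_2(\lceil k/2\rceil)$ to the center leaf of the $(\lfloor k/2\rfloor-1)$-th $2$-vertebra. If $d>2$ and $k\geq 4$, then $\xi_d(k)$ is obtained from the $\lfloor k/2\rfloor$-th $d$-spine as follows: (1) for each $1\leq i\leq\lfloor k/2\rfloor-2$, glue a copy of $\xi_d(i)$ to each of the left and right leaves of the $i$-th $d$-vertebra; (2) glue a copy of $\xi_d(\lfloor k/2\rfloor-1)$ to the right leaf of the $(\lfloor k/2\rfloor-1)$-th (second-lowest) $d$-vertebra; (3) glue a copy of $\xi_d(\lceil k/2\rceil-1)$ to the left leaf of the $(\lfloor k/2\rfloor-1)$-th $d$-vertebra; (4) glue a copy of $\xi_d(\lceil k/2\rceil)$ to the center leaf of the $\lfloor k/2\rfloor$-th (lowest) $d$-vertebra; (5) glue a copy of $\xi_d(\lfloor (k+1)/4\rfloor)$ to each of the left and right leaves of the $\lfloor k/2\rfloor$-th $d$-vertebra. *)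

(* Defs.v *)
From mathcomp Require Import all_boot zify.
From Stdlib Require Import Relation_Operators.

Set Implicit Arguments.
Unset Strict Implicit.
Unset Printing Implicit Defensive.

(* Positions are 0-based: the i-th subtree, and the edge type i, for
   1 <= i <= d, are those of the ordinal with value i.-1 in 'I_d. *)
Inductive dtree (d : nat) : Type :=
| Empty
| Node of {ffun 'I_d -> dtree d}.

Arguments Empty {d}.
Arguments Node {d} f.

Section PlaneTrees.
Variable d : nat.
Implicit Types (T U : dtree d) (f g : {ffun 'I_d -> dtree d}) (v w : seq 'I_d).

Definition is_empty T : bool := if T is Empty then true else false.

Fixpoint nverts T : nat :=
  if T is Node f then (\sum_(i < d) nverts (f i)).+1 else 0.

Definition chi f : {set 'I_d} := [set i | ~~ is_empty (f i)].

Definition set_child f (i : 'I_d) T : {ffun 'I_d -> dtree d} :=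
  [ffun j => if j == i then T else f j].

(* When no position is nonempty in both [f] and [g], this is the vertex
   obtained by identifying a vertex with subtrees [f] and one with subtrees
   [g]; every use below is conflict-free. *)
Definition merge f g : {ffun 'I_d -> dtree d} :=
  [ffun j => if is_empty (f j) then g j else f j].

(* Contraction of the type-[i] edge from a vertex with subtrees [f] to its
   child, which has subtrees [g]. The condition that l lies strictly beyond j
   for every l in chi g is the comparison of j with min (chi g) or
   max (chi g), and it is vacuous when chi g is empty. *)
Definition legal f (i : 'I_d) g : Prop :=
  forall j, j \in chi f :\ i ->
    (j < i -> forall l, l \in chi g -> j < l) /\
    (i < j -> forall l, l \in chi g -> l < j).

Inductive contracts : dtree d -> dtree d -> Prop :=
| contracts_root f i g :
    f i = Node g -> legal f i g ->
    contracts (Node f) (Node (merge (set_child f i Empty) g))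
| contracts_child f i T :
    contracts (f i) T -> contracts (Node f) (Node (set_child f i T)).

Definition noncontiguously_contains U T : Prop :=
  clos_refl_trans (dtree d) contracts U T.

Definition universal (k : nat) U : Prop :=
  forall T, nverts T = k -> noncontiguously_contains U T.

(* [is_Nnon k n] says that n is the value of N_{d-ary}^{non}(k); in
   particular it asserts that the minimum is attained. *)
Definition is_Nnon (k n : nat) : Prop :=
  (exists2 U, universal k U & nverts U = n) /\
  (forall U, universal k U -> n <= nverts U).

(* A vertex is designated by its address, the word of edge types read on the
   path from the root. If [v] is not the address of a vertex of T, or if
   [S] is [Empty], then [glue S v T] is T; this never occurs below. Gluing
   does not change the addresses of the vertices of T. *)
Fixpoint glue (S : dtree d) v T : dtree d :=
  match T, v with
  | Empty, _ => Empty
  | Node f, [::] => if S is Node g then Node (merge f g) else T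
  | Node f, i :: v' => Node (set_child f i (glue S v' (f i)))
  end.

Definition leaf : dtree d := Node [ffun=> Empty].

Fixpoint path_tree w : dtree d :=
  if w is i :: w' then Node (set_child [ffun=> Empty] i (path_tree w'))
  else leaf.

(* The word 1, ..., d of all the edge types, in increasing order. *)
Definition types : seq 'I_d := enum 'I_d.

Definition crescent : dtree d := path_tree types.

Definition vertebra : dtree d :=
  glue (path_tree (drop 1 types)) [::]
    (glue (path_tree (take d.-1 types)) (take 1 types) crescent).

(* Addresses, in a spine, of the root and of the three leaves of the i-th
   vertebra (i >= 1): the root of the first vertebra is the bottom of the
   crescent, and the center leaf of a vertebra has address [types] in it. *)
Definition vroot (i : nat) : seq 'I_d := flatten (nseq i types).
Definition left_leaf (i : nat) : seq 'I_d :=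
  vroot i ++ take 1 types ++ take d.-1 types.
Definition center_leaf (i : nat) : seq 'I_d := vroot i ++ types.
Definition right_leaf (i : nat) : seq 'I_d := vroot i ++ drop 1 types.

Fixpoint spine (m : nat) : dtree d :=
  if m is m'.+1 then glue vertebra (vroot m) (spine m') else crescent.

(* [glue_sides X n T] glues X i to the left and right leaves of the i-th
   vertebra of T, for 1 <= i <= n. *)
Fixpoint glue_sides (X : nat -> dtree d) (n : nat) T : dtree d :=
  if n is n'.+1
  then glue (X n) (left_leaf n) (glue (X n) (right_leaf n) (glue_sides X n' T))
  else T.

(* In [xi_step_two] and [xi_step_gt2], h is the floor of k/2 and c its
   ceiling. *)
Definition xi_step_two (X : nat -> dtree d) (k : nat) : dtree d :=
  let h := k./2 in
  let c := uphalf k in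
  let T1 := glue_sides X (h - 2) (spine (h - 1)) in
  let T2 := glue (X (h - 1)) (right_leaf (h - 1)) T1 in
  let T3 := glue (X (c - 1)) (left_leaf (h - 1)) T2 in
  glue (X c) (center_leaf (h - 1)) T3.

Definition xi_step_gt2 (X : nat -> dtree d) (k : nat) : dtree d :=
  let h := k./2 in
  let c := uphalf k in
  let T1 := glue_sides X (h - 2) (spine h) in
  let T2 := glue (X (h - 1)) (right_leaf (h - 1)) T1 in
  let T3 := glue (X (c - 1)) (left_leaf (h - 1)) T2 in
  let T4 := glue (X c) (center_leaf h) T3 in
  let q := k.+1 %/ 4 in
  glue (X q) (left_leaf h) (glue (X q) (right_leaf h) T4).

Definition xi_step (X : nat -> dtree d) (k : nat) : dtree d :=
  match k with
  | 0 => Empty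
  | 1 => leaf
  | 2 => crescent
  | 3 => glue (Node [ffun=> leaf]) types crescent
  | _ => if d == 2 then xi_step_two X k else xi_step_gt2 X k
  end.

(* The recursion on k is run with fuel; [xiE] below is the intended
   recursive equation. The value at 0 is a dummy that is never used. *)
Fixpoint xi_fuel (n k : nat) : dtree d :=
  if n is n'.+1 then xi_step (xi_fuel n') k else Empty.

Definition xi (k : nat) : dtree d := xi_fuel k.+1 k.

Definition M (k : nat) : nat := nverts (xi k).

Lemma eq_glue_sides X Y n T :
  (forall i, i <= n -> X i = Y i) -> glue_sides X n T = glue_sides Y n T.
Proof.
elim: n => //= n IHn eqXY.
by rewrite eqXY // IHn // => i le_in; apply: eqXY; apply: leqW.
Qed.

Lemma eq_xi_step X Y k :
  (forall i, i < k -> X i = Y i) -> xi_step X k = xi_step Y k.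
Proof.
case: k => [|[|[|[|k]]]] // eqXY.
have eqsub a b : a < k.+4 -> X (a - b) = Y (a - b).
  by move=> lt_a; apply: eqXY; apply: leq_ltn_trans (leq_subr b a) lt_a.
have lth : k.+4./2 < k.+4 by lia.
have ltc : uphalf k.+4 < k.+4 by lia.
have ltq : k.+4.+1 %/ 4 < k.+4 by lia.
have eqsides T : glue_sides X (k.+4./2 - 2) T = glue_sides Y (k.+4./2 - 2) T.
  by apply: eq_glue_sides => i le_i; apply: eqXY; lia.
rewrite /xi_step /xi_step_two /xi_step_gt2 !eqsides.
by rewrite !(eqsub _ _ lth) !(eqsub _ _ ltc) !(eqXY _ ltc) !(eqXY _ ltq).
Qed.

Lemma xi_fuelE n k : k < n -> xi_fuel n k = xi k.
Proof.
have fuelE m m' : m <= m' -> forall j, j < m -> xi_fuel m' j = xi_fuel m j.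
  elim: m m' => // m IHm [//|m'] le_mm' j lt_jm /=.
  by apply: eq_xi_step => i lt_ij; apply: IHm => //; apply: leq_trans lt_ij _.
by move=> lt_kn; apply: fuelE.
Qed.

Lemma xiE k : xi k = xi_step xi k.
Proof. by apply: eq_xi_step => i /xi_fuelE. Qed.

End PlaneTrees.

(* Main.v *)
Require Import Defs.
From mathcomp Require Import all_boot all_order all_algebra.
From mathcomp Require Import all_classical all_reals all_analysis.
From mathcomp Require Import zify ring lra.
From Stdlib Require Import Relation_Operators.
Import Order.TTheory GRing.Theory Num.Theory numFieldNormedType.Exports.

Set Implicit Arguments.
Unset Strict Implicit.
Unset Printing Implicit Defensive.

(** The inequality holds because xi d k itself contains every tree with k
    vertices. Two remarks make containment easy to establish: a subtree can
    always be deleted (contract it leaf by leaf), and a chain of vertices with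
    one child each can always be collapsed. So each building block of xi can be
    specialised at will. A crescent turns into a single edge of any type, or
    into a single vertex. A vertebra with A, B and C glued to its left, right
    and center leaves can be turned, for X contained in C, into an edge of any
    type leading to X, or into X with one more child subtree S at the far left
    (S contained in A) or at the far right (S contained in B).

    Now read a tree T with k vertices from its root while walking down the
    spine. When the root has a single child, descend to it; otherwise peel off
    its leftmost or its rightmost child subtree. After R vertices have been
    removed, the vertebrae numbered at most R are used up, and the remaining
    k - R vertices have to be found below them. A peeled subtree of size s
    brings the number of removed vertices to R + s, hence goes to vertebra
    R + s, whose side trees are large enough since s <= R + s; the vertebrae in
    between are collapsed. Once half of the vertices are gone, the rest fits
    into the copy of xi glued at the bottom, by induction on k. The side trees
    of the lowest vertebrae take care of the moves that cross the middle
    (column_covers). In the binary case peeling one child leaves only one, so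
    one vertebra both peels and descends, which saves a vertebra
    (stem_covers_binary).

    For the size, gluing turns the construction into a recursion: M d k is at
    most O(k) times the largest M d i with i <= (k+1)/2, and at least the sum of
    the M d i for i <= (k+1)/2. The first gives
    M d k <= (3d)^(L+1) 2^(L(L+1)/2) when k <= 2^L (M_upper). The second, with
    the bound c^(m+1)/(m+1) on the sum of the m-th powers up to c, gives
    k^m <= M d k * m! * 2^(m(m+1)/2) for all m (M_lower). With m the integer part
    of log2 k, both bounds have the logarithm (log2 k)^2/2 in base 2, up to
    O(m^(3/2)), so the relative error is O(1/sqrt(log2 k)). *)

Local Notation merge := Defs.merge.
Local Notation Empty := Defs.Empty.
Local Notation glue := Defs.glue.
Local Notation "U >~ T" := (noncontiguously_contains U T)
  (at level 70, no associativity).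

(** * Containment and contractions *)

Section Containment.
Variable d : nat.
Implicit Types (S T U X : dtree d) (f g : {ffun 'I_d -> dtree d}).
Implicit Types (i j l : 'I_d) (w : seq 'I_d).

Local Notation no_child := [ffun=> Empty] (only parsing).

Lemma contains_refl T : T >~ T.
Proof. exact: rt_refl. Qed.

Lemma contains_trans U T S : U >~ T -> T >~ S -> U >~ S.
Proof. exact: rt_trans. Qed.

Lemma contains_child f i T : f i >~ T -> Node f >~ Node (set_child f i T).
Proof.
have set_same g : set_child g i (g i) = g.
  by apply/ffunP=> j; rewrite ffunE; case: eqP => [->|].
have set_set g X Y : set_child (set_child g i X) i Y = set_child g i Y.
  by apply/ffunP=> j; rewrite !ffunE; case: eqP.
suff gen U : U >~ T -> Node (set_child f i U) >~ Node (set_child f i T).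
  by move/gen; rewrite set_same.
elim=> {U T} [U T UT|U|U T S _ IH1 _ IH2].
- rewrite -(set_set f U T); apply/rt_step/contracts_child.
  by rewrite ffunE eqxx.
- exact: contains_refl.
- exact: contains_trans IH1 IH2.
Qed.

Lemma contains_set_child f i U T :
  U >~ T -> Node (set_child f i U) >~ Node (set_child f i T).
Proof.
move=> UT; rewrite (_ : set_child f i T = set_child (set_child f i U) i T).
  by apply: contains_child; rewrite ffunE eqxx.
by apply/ffunP=> j; rewrite !ffunE; case: eqP.
Qed.

(** A contraction seen from the result: [f] holds the other subtrees of the
    vertex, and all types in [g] lie in the gap of [f] that contains [i]. *)
Lemma contract_edge f i g :
  is_empty (f i) ->
  (forall j, ~~ is_empty (f j) ->
     (j < i -> forall l, l \in chi g -> j < l) /\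
     (i < j -> forall l, l \in chi g -> l < j)) ->
  Node (set_child f i (Node g)) >~ Node (merge f g).
Proof.
move=> fi0 gap; pose f' := set_child f i (Node g).
have -> : merge f g = merge (set_child f' i Empty) g.
  by apply/ffunP=> j; rewrite !ffunE; case: eqP => // ->; rewrite fi0.
apply/rt_step/contracts_root; first by rewrite ffunE eqxx.
move=> j; rewrite !inE ffunE => /andP[/negPf-> ne_fj]; exact: gap.
Qed.

Lemma is_empty_eq T : is_empty T -> T = Empty.
Proof. by case: T. Qed.

Lemma nverts_eq0 T : (nverts T == 0) = is_empty T.
Proof. by case: T. Qed.

Lemma nverts_child f i : nverts (f i) < nverts (Node f).
Proof. by rewrite /= ltnS (bigD1 i) //= leq_addr. Qed.

Lemma nverts_set_child f i T :
  nverts (f i) + nverts (Node (set_child f i T)) = nverts T + nverts (Node f).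
Proof.
rewrite /= (bigD1 i) //= [in RHS](bigD1 i) //= ffunE eqxx.
rewrite (eq_bigr (fun j => nverts (f j))); first by lia.
by move=> j /negPf ne_ji; rewrite ffunE ne_ji.
Qed.

Lemma contract_leaf f i : Node (set_child f i (leaf d)) >~ Node (set_child f i Empty).
Proof.
pose f' := set_child f i Empty.
have -> : set_child f i (leaf d) = set_child f' i (leaf d).
  by apply/ffunP=> j; rewrite !ffunE; case: eqP.
have -> : set_child f i Empty = merge f' no_child.
  apply/ffunP=> j; rewrite !ffunE; case: eqP => //= _.
  by case: (f j).
apply: contract_edge; first by rewrite ffunE eqxx.
by move=> j _; split=> _ l; rewrite inE ffunE.
Qed.

(** Leaves can always be contracted, so every subtree can be removed, starting
    with its deepest vertices. *)
Lemma node_contains_leaf f : Node f >~ leaf d.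
Proof.
have [n] := ubnP (nverts (Node f)); elim: n f => // n IHn f le_fn.
have [/existsP[i]|/existsPn f0] := boolP [exists i, ~~ is_empty (f i)]; last first.
  suff -> : f = no_child by exact: contains_refl.
  by apply/ffunP=> j; rewrite ffunE; apply/is_empty_eq/negbNE/f0.
have := nverts_child f i; have := nverts_set_child f i Empty.
case fi: (f i) => [//|g] szf szg _.
have fi_leaf : f i >~ leaf d by rewrite fi; apply: IHn; lia.
apply: contains_trans (contains_child fi_leaf) _.
apply: contains_trans (contract_leaf f i) _.
by apply: IHn; move: szf; rewrite /=; move: szg le_fn => /=; lia.
Qed.

Lemma prune f i : Node f >~ Node (set_child f i Empty).
Proof.
case fi: (f i) => [|g].
  rewrite (_ : set_child f i Empty = f); first exact: contains_refl.
  by apply/ffunP=> j; rewrite ffunE; case: eqP => // ->.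
apply: contains_trans (contract_leaf f i).
by apply: contains_child; rewrite fi; apply: node_contains_leaf.
Qed.

Definition grow w X : dtree d :=
  foldr (fun i T => Node (set_child no_child i T)) X w.

Lemma grow_leaf w : path_tree w = grow w (leaf d).
Proof. by elim: w => //= i w ->. Qed.

Lemma is_empty_grow w X : ~~ is_empty X -> ~~ is_empty (grow w X).
Proof. by case: w. Qed.

Lemma collapse1 i X : ~~ is_empty X -> Node (set_child no_child i X) >~ X.
Proof.
case: X => // g _; rewrite -{2}(_ : merge no_child g = g).
  by apply: contract_edge => [|j]; rewrite ffunE.
by apply/ffunP=> j; rewrite !ffunE.
Qed.

(** In a chain of only children no sibling can obstruct a contraction. *)
Lemma collapse w X : ~~ is_empty X -> grow w X >~ X.
Proof.
move=> X0; elim: w => [|i w IHw] /=; first exact: contains_refl.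
by apply: contains_trans IHw; apply/collapse1/is_empty_grow.
Qed.

Lemma contains_grow w U T : U >~ T -> grow w U >~ grow w T.
Proof. by move=> UT; elim: w => //= i w /contains_set_child. Qed.

(** A path that starts among the children [f] of a vertex reduces to the one
    edge of type [l]: contracting its first edge replaces the first type of the
    path by the next one, which is legal as long as the path type stays in the
    same gap of [f]. This is how a crescent provides an edge of any type. *)
Lemma slide_child f l S p w :
  ~~ is_empty S -> sorted (fun i j : 'I_d => i < j) (p :: w) -> l \in p :: w ->
  (forall j, ~~ is_empty (f j) -> l < j \/ {in p :: w, forall i, j < i}) ->
  Node (set_child f p (grow w S)) >~ Node (set_child f l S).
Proof.
move=> S0; have lt_tr : transitive (fun i j : 'I_d => i < j).
  by move=> y x z; apply: ltn_trans.
elim: w p => [|p' w IHw] p sort_w lw gap.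
  by move: lw; rewrite inE => /eqP->; apply: contains_refl.
move: lw; rewrite inE => /predU1P[->|lw].
  by apply/contains_set_child/collapse.
have /allP lt_p : all (fun i : 'I_d => p < i) (p' :: w).
  exact: order_path_min lt_tr sort_w.
have le_p'l : p' <= l.
  move: lw; rewrite inE => /predU1P[->//|lw]; apply: ltnW.
  by move/allP: (order_path_min lt_tr (path_sorted sort_w)); apply.
have empty_f i : i \in p :: p' :: w -> i <= l -> is_empty (f i).
  move=> iw le_il; apply: negbNE; apply/negP => /gap [|/(_ i iw)]; last by rewrite ltnn.
  by rewrite ltnNge le_il.
have lt_pl := lt_p _ lw.
apply: contains_trans _ (IHw p' (path_sorted sort_w) lw _).
- rewrite (_ : set_child f p' _ = merge f (set_child no_child p' (grow w S))).
    apply: contract_edge; first by apply: empty_f; rewrite ?mem_head // ltnW.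
    move=> j /gap gap_j; split=> lt_j i; rewrite inE !ffunE; case: eqP => // -> _.
      case: gap_j => [lt_lj|]; first lia.
      by apply; rewrite !inE eqxx orbT.
    by case: gap_j => [|/(_ p (mem_head _ _))]; lia.
  apply/ffunP=> j; rewrite !ffunE; case: eqP => [->|_].
    by rewrite empty_f // !inE eqxx orbT.
  by case: (f j).
- move=> j /gap [|lt_j]; first by left.
  by right=> i iw; apply: lt_j; rewrite inE iw orbT.
Qed.

(** Trees with fewer than [n] vertices are included so that the notion is
    monotone in [n]. *)
Definition covers n U := forall T, 0 < nverts T <= n -> U >~ T.

End Containment.

(** * Vertebrae *)

(** Writing the number of types as [n.+2] makes the two lowest types explicit. *)
Section Vertebrae.
Variable n : nat.
Local Notation d := n.+2.
Implicit Types (S T U X : dtree d) (f g : {ffun 'I_d -> dtree d}).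
Implicit Types (i j l r : 'I_d) (w : seq 'I_d).

Local Notation no_child := [ffun=> Empty] (only parsing).
Local Notation lt_ord := (fun i j : 'I_d => i < j).

Definition type0 : 'I_d := ord0.
Definition type1 : 'I_d := lift ord0 ord0.
Definition high_types : seq 'I_d := drop 2 (types d).
(** Counting types from 1, these are 2, ..., d - 1: what follows the lowest type
    on the path to a left leaf. *)
Definition mid_types : seq 'I_d := take n (type1 :: high_types).

Lemma typesE : types d = [:: type0, type1 & high_types].
Proof. by rewrite /high_types /types !enum_ordSl /= ?drop0. Qed.

Lemma sorted_types : sorted lt_ord (types d).
Proof.
have := iota_ltn_sorted 0 d; rewrite -val_enum_ord.
by rewrite sorted_map.
Qed.

Lemma mem_types i : i \in types d.
Proof. exact: mem_enum. Qed.

Lemma size_high : size high_types = n.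
Proof. by rewrite size_drop size_enum_ord subn2. Qed.

Lemma take_types m : take m.+1 (types d) = type0 :: take m (type1 :: high_types).
Proof. by rewrite typesE. Qed.

Lemma drop1_types : drop 1 (types d) = type1 :: high_types.
Proof. by rewrite typesE. Qed.

Definition fork T1 T2 : dtree d :=
  Node (set_child (set_child no_child type0 T1) type1 T2).

(** The vertebra with [A], [B] and [C] at its left, right and center leaves
    (see [vertebraE]). Its root carries the path to [B] and an edge of the lowest
    type; the lower end of that edge carries the paths to [A] and to [C]. *)
Definition vert A B C : dtree d :=
  fork (fork (grow mid_types A) (grow high_types C)) (grow high_types B).

Lemma contains_fork U1 U2 T1 T2 :
  U1 >~ T1 -> U2 >~ T2 -> fork U1 U2 >~ fork T1 T2.
Proof.
move=> UT1 UT2; apply: contains_trans (contains_set_child _ _ UT2).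
have swap U : fork U U2 = Node (set_child (set_child no_child type1 U2) type0 U).
  by congr Node; apply/ffunP=> j; rewrite !ffunE; case: eqP => // ->.
by rewrite swap [X in _ >~ X]swap; apply: contains_set_child.
Qed.

Lemma fork_left T1 T2 : ~~ is_empty T1 -> fork T1 T2 >~ T1.
Proof.
move=> T1_0; apply: contains_trans (prune _ type1) _.
rewrite (_ : set_child _ _ _ = set_child no_child type0 T1); first exact: collapse1.
by apply/ffunP=> j; rewrite !ffunE; do 2?case: eqP => // ->.
Qed.

Lemma fork_right T1 T2 : ~~ is_empty T2 -> fork T1 T2 >~ T2.
Proof.
move=> T2_0; apply: contains_trans (prune _ type0) _.
rewrite (_ : set_child _ _ _ = set_child no_child type1 T2); first exact: collapse1.
by apply/ffunP=> j; rewrite !ffunE; do 2?case: eqP => // ->.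
Qed.

Lemma vert_center A B C : ~~ is_empty C -> vert A B C >~ C.
Proof.
move=> C0; apply: contains_trans (fork_left _ _) _ => //.
by apply: contains_trans (collapse _ C0); apply/fork_right/is_empty_grow.
Qed.

Lemma grow_descend i C : ~~ is_empty C ->
  grow (types d) C >~ Node (set_child no_child i C).
Proof.
move=> C0; have i_t := mem_types i; move: sorted_types i_t; rewrite typesE.
move=> st it /=; apply: (slide_child (f := no_child)) st it _ => // j.
by rewrite ffunE.
Qed.

Lemma vert_descend i A B C : ~~ is_empty C ->
  vert A B C >~ Node (set_child no_child i C).
Proof.
move=> C0; apply: contains_trans (grow_descend i C0).
rewrite typesE; apply: contains_trans (prune _ type1) _.
rewrite (_ : set_child _ _ _ = set_child no_child type0 
   (fork (grow mid_types A) (grow high_types C))); last first.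
  by apply/ffunP=> j; rewrite !ffunE; do 2?case: eqP => // ->.
apply: contains_set_child; apply: contains_trans (prune _ type0) _.
rewrite (_ : set_child _ _ _ = set_child no_child type1 (grow high_types C)).
  exact: contains_refl.
by apply/ffunP=> j; rewrite !ffunE; do 2?case: eqP => // ->.
Qed.

Lemma vert_left_arm A B C : ~~ is_empty C ->
  vert A B C >~ fork (grow mid_types A) C.
Proof.
move=> C0; apply: contains_trans (fork_left _ _) _ => //.
by apply: contains_fork (contains_refl _) (collapse _ C0).
Qed.

Lemma vert_right_arm A B C : ~~ is_empty C ->
  vert A B C >~ fork C (grow high_types B).
Proof.
move=> C0; apply: contains_fork (contains_refl _).
by apply: contains_trans (collapse high_types C0); apply/fork_right/is_empty_grow.
Qed.

Lemma val_type1 : val type1 = 1. Proof. by []. Qed.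

Lemma vert_fork_left A B C :
  ~~ is_empty A -> ~~ is_empty C -> vert A B C >~ fork A C.
Proof.
move=> A0 C0; apply: contains_trans (vert_left_arm _ _ C0) _.
exact: contains_fork (collapse _ A0) (contains_refl _).
Qed.

Lemma vert_fork_right A B C :
  ~~ is_empty B -> ~~ is_empty C -> vert A B C >~ fork C B.
Proof.
move=> B0 C0; apply: contains_trans (vert_right_arm _ _ C0) _.
exact: contains_fork (contains_refl _) (collapse _ B0).
Qed.

(** Reduce the path to [C] first. The path to [A] starts at the lowest type,
    so its types up to [l] lie in the gap to the left of [g], and the path
    slides to [l]. *)
Lemma vert_peel_left A B C S g l :
  ~~ is_empty S -> A >~ S -> C >~ Node g -> ~~ is_empty C ->
  (forall j, j \in chi g -> l < j) -> l < n.+1 ->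
  vert A B C >~ Node (set_child g l S).
Proof.
move=> S0 AS Cg C0 gap lt_l; apply: contains_trans (vert_left_arm _ _ C0) _.
apply: contains_trans (contains_fork (contains_grow _ AS) Cg) _.
have l_t : l \in type0 :: mid_types.
  by rewrite -take_types in_take ?mem_types // index_enum_ord.
have sort_t : sorted lt_ord (type0 :: mid_types).
  by rewrite -take_types; apply/take_sorted/sorted_types.
have gap' j : ~~ is_empty (g j) -> l < j by move=> gj; apply: gap; rewrite inE.
apply: contains_trans (slide_child S0 sort_t l_t _); last by left; apply: gap'.
rewrite (_ : set_child g _ _ =
  merge (set_child no_child type0 (grow mid_types S)) g).
  apply: contract_edge; first by rewrite !ffunE.
  move=> j; rewrite !ffunE; case: eqP => // -> _; split=> // _ i /gap.
  exact: leq_trans.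
apply/ffunP=> j; rewrite !ffunE; case: eqP => // _.
by rewrite (negPf (is_empty_grow _ S0)).
Qed.

(** The mirror image needs another order. The path to [B] has to slide to [l]
    before [g] is merged into the root, while the root still has only the lowest
    type besides that path; [g] then replaces that type, to the left of [l]. *)
Lemma vert_peel_right A B C S g l :
  ~~ is_empty S -> B >~ S -> C >~ Node g -> ~~ is_empty C ->
  (forall j, j \in chi g -> j < l) -> 0 < l ->
  vert A B C >~ Node (set_child g l S).
Proof.
move=> S0 BS Cg C0 gap l_gt0; apply: contains_trans (vert_right_arm _ _ C0) _.
apply: contains_trans (contains_fork Cg (contains_grow _ BS)) _.
have l_t : l \in type1 :: high_types.
  have := mem_types l; rewrite typesE inE => /predU1P[l0|//].
  by rewrite l0 in l_gt0.
have sort_t : sorted lt_ord (type1 :: high_types).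
  by rewrite -drop1_types; apply/drop_sorted/sorted_types.
have lt0 : {in type1 :: high_types, forall i, type0 < i}.
  move=> i i_t; move: sorted_types; rewrite typesE => /order_path_min.
  by move=> /(_ (fun y x z => @ltn_trans y x z))/allP/(_ i i_t).
pose f := set_child no_child type0 (Node g).
apply: contains_trans (slide_child (f := f) S0 sort_t l_t _) _.
  by move=> j; rewrite !ffunE; case: eqP => // -> _; right.
pose f' := set_child no_child l S.
have l_ne0 : type0 == l = false by case: eqP l_gt0 => // <-.
rewrite (_ : set_child f l S = set_child f' type0 (Node g)); last first.
  apply/ffunP=> j; rewrite !ffunE; have [->|] := eqVneq j type0; first by rewrite l_ne0.
  by [].
rewrite (_ : set_child g l S = merge f' g).
  apply: contract_edge; first by rewrite !ffunE l_ne0.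
  move=> j; rewrite !ffunE; case: eqP => // -> _; split=> // _ i; exact: gap.
apply/ffunP=> j; rewrite !ffunE; case: eqP => // _.
by rewrite (negPf S0).
Qed.

Lemma nverts_set_empty i X : nverts (Node (set_child no_child i X)) = (nverts X).+1.
Proof.
have := nverts_set_child no_child i X; rewrite /= ffunE /=.
rewrite [X in _ = _ + X.+1]big1 => [|j _]; last by rewrite ffunE.
by lia.
Qed.

Lemma nverts_grow w X : nverts (grow w X) = size w + nverts X.
Proof. by elim: w => // i w IHw; rewrite [grow _ _]/= nverts_set_empty IHw. Qed.

Lemma nverts_fork T1 T2 : nverts (fork T1 T2) = (nverts T1 + nverts T2).+1.
Proof.
have := nverts_set_child (set_child no_child type0 T1) type1 T2.
by rewrite nverts_set_empty !ffunE /=; rewrite -/(fork T1 T2); lia.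
Qed.

Lemma nverts_vert A B C :
  nverts (vert A B C) = (3 * n).+2 + nverts A + nverts B + nverts C.
Proof.
rewrite !nverts_fork !nverts_grow size_high size_takel /= ?size_high //; lia.
Qed.

Lemma covers_le m m' U : m <= m' -> covers m' U -> covers m U.
Proof. by move=> le_m cU T szT; apply: cU; lia. Qed.

Lemma covers_trans m U V : U >~ V -> covers m V -> covers m U.
Proof. by move=> UV cV T szT; apply: contains_trans UV (cV T szT). Qed.

(** The three ways in which the peeling of a tree can proceed at its root. *)
Variant root_shape T : Prop :=
| RootLeaf of T = leaf d
| RootSingle (i : 'I_d) (X : dtree d)
    of T = Node (set_child no_child i X) & 0 < nverts X
    & nverts T = (nverts X).+1
| RootMany (l r : 'I_d) (f : {ffun 'I_d -> dtree d}) of T = Node f & l < r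
    & 0 < nverts (f l) & 0 < nverts (f r)
    & (forall j, j \in chi f -> l <= j <= r)
    & nverts (f l) + nverts (f r) < nverts T.

Lemma root_shapeP T : 0 < nverts T -> root_shape T.
Proof.
case: T => // f _.
have [i0 i0f|f0] := pickP [pred i | ~~ is_empty (f i)]; last first.
  apply: RootLeaf; congr Node; apply/ffunP=> j; rewrite ffunE.
  by apply/is_empty_eq/negbNE; have /= -> := f0 j.
pose P i := ~~ is_empty (f i).
have [l lf l_min] := @arg_minnP _ i0 P (fun i => i) i0f.
have [r rf r_max] := @arg_maxnP _ i0 P (fun i => i) i0f.
have pos i : P i -> 0 < nverts (f i) by rewrite /P -nverts_eq0 lt0n.
have [eq_lr|ne_lr] := eqVneq l r.
  have fE : f = set_child no_child l (f l).
    apply/ffunP=> j; rewrite !ffunE; have [->//|ne_jl] := eqVneq j l.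
    apply/is_empty_eq/negbNE/negP => jf; move: ne_jl; rewrite -val_eqE /=.
    have := l_min j jf; have := r_max j jf; rewrite eq_lr; lia.
  apply: (@RootSingle _ l (f l)); rewrite -?fE ?pos // [in LHS]fE.
  exact: nverts_set_empty.
apply: (@RootMany _ l r f) => //; try exact: pos.
- have := r_max l lf; move: ne_lr; rewrite -val_eqE /=; lia.
- by move=> j; rewrite inE => jf; apply/andP; split; [exact: l_min|exact: r_max].
- by rewrite /= ltnS (bigD1 l) //= (bigD1 r) 1?eq_sym //=; lia.
Qed.

Lemma nverts_del f i :
  nverts (f i) + nverts (Node (set_child f i Empty)) = nverts (Node f).
Proof. exact: nverts_set_child. Qed.

Lemma set_del f i : set_child (set_child f i Empty) i (f i) = f.
Proof. by apply/ffunP=> j; rewrite !ffunE; case: eqP => // ->. Qed.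

Lemma chi_del f i j : j \in chi (set_child f i Empty) -> j != i /\ j \in chi f.
Proof. by rewrite !inE ffunE; case: eqP. Qed.

(** * Columns of vertebrae *)

Fixpoint column (A B : nat -> dtree d) (j m : nat) C : dtree d :=
  if m is m'.+1 then vert (A j) (B j) (column A B j.+1 m' C) else C.

Lemma eq_column A B A' B' (j m : nat) C :
  (forall i : nat, j <= i < j + m -> A i = A' i /\ B i = B' i) ->
  column A B j m C = column A' B' j m C.
Proof.
elim: m j => //= m IHm j eqAB; have [|-> ->] := eqAB j; first by lia.
by congr vert; apply: IHm => i ?; apply: eqAB; lia.
Qed.

Lemma columnD A B (j i m : nat) C :
  column A B j (i + m) C = column A B j i (column A B (j + i) m C).
Proof.
by elim: i j => [|i IHi] j; rewrite ?addn0 //= IHi addnS addSn.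
Qed.

Lemma is_empty_column A B (j m : nat) C : ~~ is_empty C -> ~~ is_empty (column A B j m C).
Proof. by case: m. Qed.

Lemma column_center A B (j m : nat) C : ~~ is_empty C -> column A B j m C >~ C.
Proof.
move=> C0; elim: m j => [|m IHm] j /=; first exact: contains_refl.
by apply: contains_trans (IHm _); apply/vert_center/is_empty_column.
Qed.

Lemma nverts_column A B (j m : nat) C : nverts (column A B j m C) =
  \sum_(j <= i < j + m) ((3 * n).+2 + nverts (A i) + nverts (B i)) + nverts C.
Proof.
elim: m j => [|m IHm] j; first by rewrite addn0 big_geq.
rewrite [column _ _ _ _ _]/= nverts_vert IHm [in RHS]big_ltn; last by lia.
by rewrite (addSnnS j m) addnA; reflexivity.
Qed.

(** The vertebrae above the [j]-th one are collapsed. *)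
Lemma column_vert A B C (R j H : nat) : ~~ is_empty C -> R < j <= H ->
  column A B R.+1 (H - R) C >~
  vert (A j) (B j) (column A B j.+1 (H - j) C).
Proof.
move=> C0 lt_j; have -> : H - R = (j.-1 - R) + (H - j).+1 by lia.
rewrite columnD (_ : R.+1 + (j.-1 - R) = j); last by lia.
exact: column_center.
Qed.

Lemma node2 f l r : n = 0 -> l < r -> Node f = fork (f l) (f r).
Proof.
move=> n0 lt_lr; congr Node; apply/ffunP=> i; rewrite !ffunE.
have l0 : l = type0 by apply/val_inj => /=; have := ltn_ord r; lia.
have r1 : r = type1 by apply/val_inj; rewrite val_type1 /=; have := ltn_ord r; lia.
rewrite l0 r1 in lt_lr *; have [->//|ne1] := eqVneq i type1.
have [->//|ne0] := eqVneq i type0.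
move: ne0 ne1; rewrite -!val_eqE val_type1 /=; have := ltn_ord i; lia.
Qed.

(** * Peeling a tree along a column *)

(** Here [A] and [B] are the side trees of a spine numbered from 1 and [C] is the
    tree at its bottom, with the sizes that occur in xi; [W H R] is the part
    below the [R]-th vertebra of a spine with [H] vertebrae. *)
Section GreedyPeeling.
Variables (k : nat) (A B : nat -> dtree d) (C : dtree d).
Hypothesis k_ge4 : 4 <= k.
Let h := k./2.
Let c := uphalf k.
Hypothesis C0 : ~~ is_empty C.
Hypothesis coversA : forall i : nat, 0 < i < h -> covers i (A i).
Hypothesis coversB : forall i : nat, 0 < i < h -> covers i (B i).
Hypothesis coversA_penult : covers c.-1 (A h.-1).
Hypothesis coversC : covers c C.

Local Notation W H R := (column A B R.+1 (H - R) C).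

Let W0 (H R : nat) : ~~ is_empty (W H R).
Proof. exact: is_empty_column. Qed.

Lemma column_descend (H R : nat) i X : R < H -> W H R.+1 >~ X ->
  W H R >~ Node (set_child no_child i X).
Proof.
move=> lt_RH WX; apply: contains_trans (column_vert (j := R.+1) _ _ C0 _) _.
  by rewrite leqnn.
apply: contains_trans (vert_descend i _ _ (W0 _ _)) _.
exact: contains_set_child.
Qed.

Lemma column_peel_left (H R j : nat) f l :
  R < j <= H -> 0 < nverts (f l) -> l < n.+1 ->
  (forall i, i \in chi f -> l <= i) ->
  covers (nverts (f l)) (A j) ->
  covers (nverts (Node f) - nverts (f l)) (W H j) -> W H R >~ Node f.
Proof.
move=> lt_j l0 lt_l l_min cA cW; apply: contains_trans (column_vert _ _ C0 lt_j) _.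
rewrite -(set_del f l); apply: vert_peel_left => //.
- by rewrite -nverts_eq0 -lt0n.
- by apply: cA; rewrite l0 leqnn.
- by apply: cW; rewrite -(nverts_del f l) addKn leqnn.
- move=> i /chi_del[ne_il /l_min]; move: ne_il; rewrite -val_eqE /=; lia.
Qed.

Lemma column_peel_right (H R j : nat) f r :
  R < j <= H -> 0 < nverts (f r) -> 0 < r ->
  (forall i, i \in chi f -> i <= r) ->
  covers (nverts (f r)) (B j) ->
  covers (nverts (Node f) - nverts (f r)) (W H j) -> W H R >~ Node f.
Proof.
move=> lt_j r0 lt_r r_max cB cW; apply: contains_trans (column_vert _ _ C0 lt_j) _.
rewrite -(set_del f r); apply: vert_peel_right => //.
- by rewrite -nverts_eq0 -lt0n.
- by apply: cB; rewrite r0 leqnn.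
- by apply: cW; rewrite -(nverts_del f r) addKn leqnn.
- move=> i /chi_del[ne_ir /r_max]; move: ne_ir; rewrite -val_eqE /=; lia.
Qed.

(** Downward induction on [R]: what is left of the tree after the removal of
    [R] vertices fits below the [R]-th vertebra. The two lowest vertebrae serve
    the move that takes the number of removed vertices past the middle: when
    [R = h.-1] the smaller of the two outer subtrees has at most [c./2] vertices,
    and for smaller [R] an outer subtree that crosses the middle has less than
    [c] vertices, or else the opposite one does not cross it. *)
Lemma column_covers (R : nat) :
  covers c./2 (A h) -> covers c./2 (B h) -> R <= h -> covers (k - R) (W h R).
Proof.
move=> cAh cBh le_Rh; have [m def_m] : exists m, m = h - R by exists (h - R).
elim/ltn_ind: m R le_Rh def_m => m IHm R le_Rh def_m.
have cov (R' : nat) : R < R' <= h -> covers (k - R') (W h R').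
  by move=> ?; apply: (IHm (h - R')) => //; lia.
have [->|lt_Rh] : R = h \/ R < h by lia.
  by rewrite subnn; apply: covers_le coversC; rewrite /h /c; lia.
move=> T /andP[T0 szT].
have [TE|i X TE X0 szX|l r f TE lt_lr l0 r0 lr_extr sz_lr] := root_shapeP T0.
- by rewrite TE; case: (W h R) (W0 h R) => // f _; apply: node_contains_leaf.
- by rewrite TE; apply/column_descend/cov; lia.
have peel_l (j : nat) : R < j <= h -> covers (nverts (f l)) (A j) ->
    nverts T - nverts (f l) <= k - j -> W h R >~ T.
  rewrite TE => lt_j cA sz; apply: (column_peel_left lt_j l0 _ _ cA _).
  + by have := ltn_ord r; lia.
  + by move=> i /lr_extr/andP[].
  + by apply: covers_le sz (cov _ lt_j).
have peel_r (j : nat) : R < j <= h -> covers (nverts (f r)) (B j) ->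
    nverts T - nverts (f r) <= k - j -> W h R >~ T.
  rewrite TE => lt_j cB sz; apply: (column_peel_right lt_j r0 _ _ cB _).
  + lia.
  + by move=> i /lr_extr/andP[].
  + by apply: covers_le sz (cov _ lt_j).
(* Only the last vertebra is left, and T has at most c.+1 vertices. *)
have [R_last|R_nlast] : R = h.-1 \/ R < h.-1 by lia.
  have [le_l|le_r] : nverts (f l) <= c./2 \/ nverts (f r) <= c./2.
    by rewrite /c /h in R_last *; lia.
  + by apply: (peel_l h); [lia | apply: covers_le cAh | rewrite /h in R_last *; lia].
  + by apply: (peel_r h); [lia | apply: covers_le cBh | rewrite /h in R_last *; lia].
have [small_l|big_l] := ltnP (R + nverts (f l)) h.
  by apply: (peel_l (R + nverts (f l))); try lia; apply: covers_le (coversA _); lia.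
(* Peeling the leftmost subtree crosses the middle: skip to vertebra h.-1, below
   which there is room for everything that remains. *)
have [mid_l|huge_l] := ltnP (nverts (f l)) c.
  apply: (peel_l h.-1); try lia.
    by apply: covers_le coversA_penult; lia.
(* The leftmost subtree has at least c vertices, so R plus the size of the
   rightmost one stays below h. *)
apply: (peel_r (R + nverts (f r))); rewrite /c /h in huge_l *; try lia.
by apply: covers_le (coversB _); rewrite /h; lia.
Qed.

(** With two types, a single vertebra serves both to peel a child and to
    descend to the other one. *)
Lemma column_branch_left (H R j : nat) f l r :
  n = 0 -> ~~ is_empty (A j) -> R < j <= H -> l < r ->
  0 < nverts (f l) -> 0 < nverts (f r) ->
  covers (nverts (f l)) (A j) -> covers (nverts (f r)) (W H j) -> W H R >~ Node f.
Proof.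
move=> n0 A0 lt_j lt_lr l0 r0 cA cW; apply: contains_trans (column_vert _ _ C0 lt_j) _.
apply: contains_trans (vert_fork_left _ A0 (W0 _ _)) _; rewrite (node2 _ n0 lt_lr).
by apply: contains_fork; [apply: cA; rewrite l0 /= | apply: cW; rewrite r0 /=].
Qed.

Lemma column_branch_right (H R j : nat) f l r :
  n = 0 -> ~~ is_empty (B j) -> R < j <= H -> l < r ->
  0 < nverts (f l) -> 0 < nverts (f r) ->
  covers (nverts (f r)) (B j) -> covers (nverts (f l)) (W H j) -> W H R >~ Node f.
Proof.
move=> n0 B0 lt_j lt_lr l0 r0 cB cW; apply: contains_trans (column_vert _ _ C0 lt_j) _.
apply: contains_trans (vert_fork_right _ B0 (W0 _ _)) _; rewrite (node2 _ n0 lt_lr).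
by apply: contains_fork; [apply: cW; rewrite l0 /= | apply: cB; rewrite r0 /=].
Qed.

Hypothesis A0 : forall i : nat, 0 < i < h -> ~~ is_empty (A i).
Hypothesis B0 : forall i : nat, 0 < i < h -> ~~ is_empty (B i).

(** Each move now removes a vertex besides the peeled subtree, so a subtree of
    size [s] goes to vertebra [R.+1 + s], or to the lowest one if that is
    beyond it. The bound [k.-1 - R] leaves one vertex for the crescent above the
    column, see [stem_covers_binary]. *)
Lemma column_covers_binary (R : nat) :
  n = 0 -> R <= h.-1 -> covers (k.-1 - R) (W h.-1 R).
Proof.
move=> n0 le_Rh; have [m def_m] : exists m, m = h - R by exists (h - R).
elim/ltn_ind: m R le_Rh def_m => m IHm R le_Rh def_m.
have cov (R' : nat) : R < R' <= h.-1 -> covers (k.-1 - R') (W h.-1 R').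
  by move=> ?; apply: (IHm (h - R')) => //; lia.
have [->|lt_Rh] : R = h.-1 \/ R < h.-1 by lia.
  by rewrite subnn; apply: covers_le coversC; rewrite /h /c; lia.
move=> T /andP[T0 szT].
have [TE|i X TE X0 szX|l r f TE lt_lr l0 r0 _ sz_lr] := root_shapeP T0.
- by rewrite TE; case: (W h.-1 R) (W0 h.-1 R) => // f _; apply: node_contains_leaf.
- by rewrite TE; apply/column_descend/cov; lia.
pose s := minn (nverts (f l)) (nverts (f r)).
pose j := minn (R.+1 + s) h.-1.
have lt_j : R < j <= h.-1 by lia.
have lt_jh : 0 < j < h by lia.
have le_sj : s <= j by move: sz_lr szT; rewrite /j /s /h; lia.
have sz_other : maxn (nverts (f l)) (nverts (f r)) <= k.-1 - j.
  by rewrite /j /s /h in lt_Rh *; lia.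
rewrite TE; have [le_lr|lt_rl] := leqP (nverts (f l)) (nverts (f r)).
- apply: (column_branch_left n0 (A0 lt_jh) lt_j lt_lr) => //.
    by apply: covers_le (coversA lt_jh); lia.
  by apply: covers_le (cov _ lt_j); lia.
- apply: (column_branch_right n0 (B0 lt_jh) lt_j lt_lr) => //.
    by apply: covers_le (coversB lt_jh); lia.
  by apply: covers_le (cov _ lt_j); lia.
Qed.

(** When the root has a single child, the crescent provides the edge to it.
    Otherwise the crescent is collapsed and the smaller child, of size [s], goes
    to vertebra [s], or to the lowest one if [s = h]. In that case [k] is odd and
    both children have [h] vertices; the tie is broken by peeling the left
    child, because the lowest left side tree is the larger one. *)
Lemma stem_covers_binary : n = 0 -> covers k (grow (types d) (W h.-1 0)).
Proof.
move=> n0 T /andP[T0 szT].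
have [TE|i X TE X0 szX|l r f TE lt_lr l0 r0 _ sz_lr] := root_shapeP T0.
- apply: contains_trans (collapse _ (W0 _ _)) _.
  by rewrite TE; case: (W h.-1 0) (W0 h.-1 0) => // f _; apply: node_contains_leaf.
- rewrite TE; apply: contains_trans (grow_descend i (W0 _ _)) _.
  by apply/contains_set_child/column_covers_binary; rewrite ?subn0 //; lia.
apply: contains_trans (collapse _ (W0 _ _)) _; rewrite TE.
pose s := minn (nverts (f l)) (nverts (f r)).
pose j := minn s h.-1.
have lt_j : 0 < j <= h.-1 by rewrite /j /s /h; lia.
have lt_jh : 0 < j < h by lia.
have sz_other : maxn (nverts (f l)) (nverts (f r)) <= k.-1 - j.
  by rewrite /j /s /h; lia.
have [le_lr|lt_rl] := leqP (nverts (f l)) (nverts (f r)).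
- apply: (column_branch_left n0 (A0 lt_jh) lt_j lt_lr) => //.
    have [lt_sh|ge_sh] := ltnP s h.
      by apply: covers_le (coversA lt_jh); lia.
    have -> : j = h.-1 by lia.
    by apply: covers_le coversA_penult; rewrite /c; lia.
  by apply: covers_le (column_covers_binary n0 _); lia.
- apply: (column_branch_right n0 (B0 lt_jh) lt_j lt_lr) => //.
    by apply: covers_le (coversB lt_jh); rewrite /h; lia.
  by apply: covers_le (column_covers_binary n0 _); lia.
Qed.

End GreedyPeeling.
End Vertebrae.

(** * Gluing and the recursive shape of xi *)

Section Gluing.
Variable n : nat.
Local Notation d := n.+2.
Implicit Types (S T U X C : dtree d) (f g : {ffun 'I_d -> dtree d}).
Implicit Types (A B : nat -> dtree d) (v w : seq 'I_d).

Local Notation no_child := [ffun=> Empty] (only parsing).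
Local Notation leaf := (leaf d).

Lemma is_empty_glue S v T : is_empty (glue S v T) = is_empty T.
Proof. by case: T v => [|f] [|i v] //=; case: S. Qed.

Lemma glue_leaf S : ~~ is_empty S -> glue S [::] leaf = S.
Proof.
by case: S => // g _; congr Node; apply/ffunP=> j; rewrite !ffunE.
Qed.

Lemma glue_grow S v w X : glue S (w ++ v) (grow w X) = grow w (glue S v X).
Proof.
elim: w => //= i w IHw; congr Node; apply/ffunP=> j; rewrite !ffunE eqxx IHw.
by case: eqP.
Qed.

Lemma glue_fork0 S v T1 T2 :
  glue S (type0 n :: v) (fork T1 T2) = fork (glue S v T1) T2.
Proof.
by congr Node; apply/ffunP=> j; rewrite !ffunE /=; do 2?case: eqP => // ->.
Qed.

Lemma glue_fork1 S v T1 T2 :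
  glue S (type1 n :: v) (fork T1 T2) = fork T1 (glue S v T2).
Proof.
by congr Node; apply/ffunP=> j; rewrite !ffunE /=; do 2?case: eqP => // ->.
Qed.

Lemma glue_vert_left S v (A B C : dtree d) :
  glue S (take 1 (types d) ++ take d.-1 (types d) ++ v) (vert A B C) =
  vert (glue S v A) B C.
Proof.
by rewrite !take_types take0 cat1s cat_cons !glue_fork0 glue_grow.
Qed.

Lemma glue_vert_center S v (A B C : dtree d) :
  glue S (types d ++ v) (vert A B C) = vert A B (glue S v C).
Proof. by rewrite typesE !cat_cons glue_fork0 glue_fork1 glue_grow. Qed.

Lemma glue_vert_right S v (A B C : dtree d) :
  glue S (drop 1 (types d) ++ v) (vert A B C) = vert A (glue S v B) C.
Proof. by rewrite drop1_types cat_cons glue_fork1 glue_grow. Qed.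

Lemma crescentE : crescent d = grow (types d) leaf.
Proof. exact: grow_leaf. Qed.

Lemma vertebraE : vertebra d = vert leaf leaf leaf.
Proof.
rewrite /vertebra !grow_leaf drop1_types !take_types crescentE typesE take0 /=.
congr Node; apply/ffunP=> j.
rewrite !ffunE /=; case: (eqVneq j (type0 n)) => [->|ne0] /=; last first.
  by case: eqP; rewrite ?drop0.
congr Node; apply/ffunP=> i; rewrite !ffunE.
case: (eqVneq i (type1 n)) => //= _.
by rewrite (negPf (is_empty_grow _ _)).
Qed.

(** Every intermediate stage of the construction of xi has this form. *)
Definition stem A B m C := grow (types d) (column A B 1 m C).

Lemma glue_column S v A B j i C :
  glue S (vroot d i ++ v) (column A B j i C) = column A B j i (glue S v C).
Proof.
by elim: i j => //= i IHi j; rewrite -catA glue_vert_center IHi.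
Qed.

Lemma stem_split A B i m C : i < m ->
  stem A B m C = grow (types d) (column A B 1 i
    (vert (A i.+1) (B i.+1) (column A B i.+2 (m - i.+1) C))).
Proof.
move=> lt_im; rewrite /stem; have -> : m = i + (m - i.+1).+1 by lia.
by rewrite columnD add1n /= (_ : i + _ - i.+1 = m - i.+1) //; lia.
Qed.

Definition update (A : nat -> dtree d) (i : nat) S :=
  fun j => if j == i then S else A j.

(** This reduces gluing at a leaf of a spine to gluing at a leaf of a single
    vertebra. *)
Lemma glue_stem S v A B i m C A' B' :
  i < m ->
  glue S v (vert (A i.+1) (B i.+1) (column A B i.+2 (m - i.+1) C)) =
    vert (A' i.+1) (B' i.+1) (column A B i.+2 (m - i.+1) C) ->
  (forall j, j != i.+1 -> A j = A' j /\ B j = B' j) ->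
  glue S (vroot d i.+1 ++ v) (stem A B m C) = stem A' B' m C.
Proof.
move=> lt_im glueE eqAB; rewrite !(stem_split _ _ _ lt_im) /= -catA glue_grow.
rewrite glue_column glueE (eq_column (A' := A') (B' := B')); last first.
  by move=> j ?; apply: eqAB; lia.
rewrite (@eq_column _ _ _ A' B' i.+2) // => j ?; apply: eqAB; lia.
Qed.

Lemma glue_left_leaf S A B i m C : ~~ is_empty S -> 0 < i <= m -> A i = leaf ->
  glue S (left_leaf d i) (stem A B m C) = stem (update A i S) B m C.
Proof.
case: i => // i S0 lt_im Ai; apply: glue_stem => //; last first.
  by move=> j /negPf; rewrite /update => ->.
rewrite -[X in _ ++ X]cats0 glue_vert_left Ai glue_leaf //.
by rewrite /update eqxx.
Qed.

Lemma glue_right_leaf S A B i m C : ~~ is_empty S -> 0 < i <= m -> B i = leaf ->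
  glue S (right_leaf d i) (stem A B m C) = stem A (update B i S) m C.
Proof.
case: i => // i S0 lt_im Bi; apply: glue_stem => //; last first.
  by move=> j /negPf; rewrite /update => ->.
rewrite -[drop 1 _]cats0 glue_vert_right Bi glue_leaf //.
by rewrite /update eqxx.
Qed.

Lemma vroot_rcons m : vroot d m ++ types d = vroot d m.+1.
Proof.
have vrootS p : vroot d p.+1 = types d ++ vroot d p by [].
by elim: m => [|m IHm]; rewrite !vrootS ?cats0 // -catA IHm.
Qed.

Lemma glue_bottom S A B m C v :
  glue S (vroot d m.+1 ++ v) (stem A B m C) = stem A B m (glue S v C).
Proof. by rewrite /= -catA glue_grow glue_column. Qed.

Lemma glue_center_leaf S A B m : ~~ is_empty S ->
  glue S (center_leaf d m) (stem A B m leaf) = stem A B m S.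
Proof.
by move=> S0; rewrite /center_leaf vroot_rcons -[vroot _ _]cats0 glue_bottom glue_leaf.
Qed.

Lemma spineE m : spine d m = stem (fun=> leaf) (fun=> leaf) m leaf.
Proof.
elim: m => [|m IHm]; first exact: crescentE.
rewrite -[LHS]/(glue (vertebra d) (vroot d m.+1) (spine d m)) IHm.
rewrite -[vroot _ _]cats0 glue_bottom vertebraE glue_leaf // /stem -(addn1 m).
by rewrite columnD.
Qed.

Lemma eq_stem A B A' B' m C :
  (forall i, 0 < i <= m -> A i = A' i /\ B i = B' i) ->
  stem A B m C = stem A' B' m C.
Proof. by move=> eqAB; congr grow; apply: eq_column => i ?; apply: eqAB; lia. Qed.

Lemma glue_sidesE (X : nat -> dtree d) p m C :
  p <= m -> (forall i, 0 < i -> ~~ is_empty (X i)) ->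
  let side := fun i => if i <= p then X i else leaf in
  glue_sides X p (stem (fun=> leaf) (fun=> leaf) m C) = stem side side m C.
Proof.
move=> le_pm X0; elim: p le_pm => [|p IHp] le_pm /=.
  by apply: eq_stem => i; case: i.
rewrite IHp ?(ltnW le_pm) // glue_right_leaf ?ltnn ?X0 //.
rewrite glue_left_leaf ?ltnn ?X0 //; apply: eq_stem => i _; rewrite /update.
have [->|ne_ip] := eqVneq i p.+1; first by rewrite leqnn.
by rewrite [i <= p.+1]leq_eqVlt (negPf ne_ip) ltnS.
Qed.

(** What the construction of [xi d k] eventually glues to the left leaf of the
    [j]-th vertebra, for both shapes of the spine. *)
Definition left_side (k j : nat) : dtree d :=
  if j == k./2 then xi d (k.+1 %/ 4)
  else if j == k./2.-1 then xi d (uphalf k).-1 else xi d j.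

Definition right_side (k j : nat) : dtree d :=
  if j == k./2 then xi d (k.+1 %/ 4) else xi d j.

Definition spine_height (k : nat) : nat := if n == 0 then k./2.-1 else k./2.

Lemma is_empty_glue_sides (X : nat -> dtree d) p T :
  is_empty (glue_sides X p T) = is_empty T.
Proof. by elim: p => //= p IHp; rewrite !is_empty_glue. Qed.

Lemma is_empty_stem A B m C : ~~ is_empty C -> ~~ is_empty (stem A B m C).
Proof. by move=> C0; apply/is_empty_grow/is_empty_column. Qed.

Lemma is_empty_xi k : 0 < k -> ~~ is_empty (xi d k).
Proof.
have stem0 A B m : ~~ is_empty (stem A B m leaf) by apply: is_empty_stem.
case: k => [|[|[|[|k]]]] // _; rewrite xiE /xi_step.
- by rewrite crescentE is_empty_grow.
- by rewrite is_empty_glue crescentE is_empty_grow.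
- by rewrite /xi_step_two /xi_step_gt2; case: eqP => _; rewrite !is_empty_glue
    is_empty_glue_sides spineE.
Qed.

Lemma xi_stem k : 4 <= k ->
  xi d k = stem (left_side k) (right_side k) (spine_height k) (xi d (uphalf k)).
Proof.
move=> k4; have -> : xi d k = if n == 0 then xi_step_two (xi d) k
    else xi_step_gt2 (xi d) k.
  by case: k k4 => [|[|[|[|k]]]] // _; rewrite xiE.
have xi0 i : 0 < i -> ~~ is_empty (xi d i) by apply: is_empty_xi.
rewrite /xi_step_two /xi_step_gt2 /spine_height; case: eqP => _.
- rewrite spineE subn1 glue_sidesE //; last by lia.
  rewrite glue_right_leaf; [|apply: xi0; lia|lia|case: ifP => //; lia].
  rewrite glue_left_leaf; [|apply: xi0; lia|lia|case: ifP => //; lia].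
  rewrite glue_center_leaf; last by apply: xi0; lia.
  apply: eq_stem => i lt_i; rewrite /update /left_side /right_side.
  rewrite !subn1; split.
    case: (eqVneq i (k./2)) => [|_]; first by lia.
    by case: eqP => // ?; rewrite ifT //; lia.
  case: (eqVneq i (k./2)) => [|_]; first by lia.
  by case: eqP => [->//|?]; rewrite ifT //; lia.
- rewrite spineE subn1 glue_sidesE //; last by lia.
  rewrite glue_right_leaf; [|apply: xi0; lia|lia|case: ifP => //; lia].
  rewrite glue_left_leaf; [|apply: xi0; lia|lia|case: ifP => //; lia].
  rewrite glue_center_leaf; last by apply: xi0; lia.
  rewrite glue_right_leaf; [|apply: xi0; lia|lia|].
  rewrite glue_left_leaf; [|apply: xi0; lia|lia|].
  + apply: eq_stem => i lt_i; rewrite /update /left_side /right_side.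
    rewrite !subn1; split.
      case: (eqVneq i (k./2)) => // ?.
      by case: eqP => // ?; rewrite ifT //; lia.
    case: (eqVneq i (k./2)) => // ?.
    by case: eqP => [->//|?]; rewrite ifT //; lia.
  + by rewrite /update; case: eqP; [lia|]; case: ifP => //; lia.
  + by rewrite /update; case: eqP; [lia|]; case: ifP => //; lia.
Qed.

Lemma nverts_leaf : nverts leaf = 1.
Proof. by rewrite /= big1 // => j _; rewrite ffunE. Qed.

(** * Universality of xi *)

Lemma nverts1 T : nverts T = 1 -> T = leaf.
Proof.
by move=> T1; case: (@root_shapeP n T) => [|//|? ? ? ?|? ? ? ? ? ? ? ?]; lia.
Qed.

(** Prune the types one at a time. *)
Lemma star_contains_small f :
  (forall i, nverts (f i) <= 1) -> Node [ffun=> leaf] >~ Node f.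
Proof.
move=> f1; pose g (s : seq 'I_d) : {ffun 'I_d -> dtree d} :=
  [ffun j => if j \in s then f j else leaf].
rewrite (_ : f = g (enum 'I_d)); last by apply/ffunP=> j; rewrite ffunE mem_enum.
elim: (enum 'I_d) => [|i s IHs].
  rewrite (_ : g [::] = [ffun=> leaf]); first exact: contains_refl.
  by apply/ffunP=> j; rewrite !ffunE.
apply: contains_trans IHs _; have [is_|i_s] := boolP (i \in s).
  rewrite (_ : g (i :: s) = g s); first exact: contains_refl.
  by apply/ffunP=> j; rewrite !ffunE inE; case: eqP => // ->; rewrite is_.
rewrite (_ : g (i :: s) = set_child (g s) i (f i)); last first.
  by apply/ffunP=> j; rewrite !ffunE inE; case: eqP => // ->.
have [fi0|fi0] := posnP (nverts (f i)).
  by rewrite (is_empty_eq (T := f i)) -?nverts_eq0 ?fi0 //; apply: prune.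
apply: contains_child; rewrite ffunE (negPf i_s) (@nverts1 (f i)).
  exact: contains_refl.
by have := f1 i; lia.
Qed.

Lemma covers_star2 : covers 2 (Node [ffun=> leaf]).
Proof.
move=> T /andP[T0 szT].
case: (root_shapeP T0) => [->|i X TE X0 szX|? ? ? ? ? ? ? ? ?]; try lia.
  exact: node_contains_leaf.
rewrite TE; apply: star_contains_small => j; rewrite ffunE.
by case: eqP; rewrite ?ffunE //; lia.
Qed.

Lemma covers_crescent : covers 2 (crescent d).
Proof.
rewrite crescentE => T /andP[T0 szT].
case: (root_shapeP T0) => [->|i X TE X0 szX|? ? ? ? ? ? ? ? ?]; try lia.
  exact: collapse.
by rewrite TE (@nverts1 X); [apply: grow_descend | lia].
Qed.

Lemma covers_xi3 : covers 3 (glue (Node [ffun=> leaf]) (types d) (crescent d)).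
Proof.
rewrite crescentE -[X in glue _ X]cats0 glue_grow glue_leaf // => T /andP[T0 szT].
case: (root_shapeP T0) => [->|i X TE X0 szX|l r f TE lt_lr l0 r0 _ sz_lr].
- by apply: contains_trans (collapse _ _) _ => //; apply: node_contains_leaf.
- rewrite TE; apply: contains_trans (grow_descend i _) _ => //.
  by apply/contains_set_child/covers_star2; lia.
- apply: contains_trans (collapse _ _) _ => //.
  rewrite TE in szT sz_lr *; apply: star_contains_small => i.
  have [->|ne_il] := eqVneq i l; first by lia.
  have := nverts_child (set_child f i Empty) l.
  by rewrite ffunE eq_sym (negPf ne_il); have := nverts_del f i; lia.
Qed.

(** Strong induction on [k]. All trees glued to the spine are values of xi at
    smaller arguments, so the induction hypothesis provides what the peeling
    argument assumes about the column. *)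
Lemma xi_covers k : 0 < k -> covers k (xi d k).
Proof.
elim/ltn_ind: k => k IHk k0; have [k4|] := leqP 4 k; last first.
  case: k k0 {IHk} => [|[|[|[|k]]]] // _ _; rewrite xiE /xi_step.
  - by move=> T szT; rewrite (@nverts1 T); [apply: contains_refl | lia].
  - exact: covers_crescent.
  - exact: covers_xi3.
rewrite xi_stem //.
have c0 : ~~ is_empty (xi d (uphalf k)) by apply: is_empty_xi; lia.
have coversL i : 0 < i < k./2 -> covers i (left_side k i).
  move=> lt_i; rewrite /left_side; case: eqP => [|_]; first by lia.
  case: eqP => [E|_]; last by apply: IHk; lia.
  by apply: (covers_le (m' := (uphalf k).-1)); [|apply: IHk]; lia.
have coversR i : 0 < i < k./2 -> covers i (right_side k i).
  move=> lt_i; rewrite /right_side; case: eqP => [|_]; first by lia.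
  by apply: IHk; lia.
have coversLp : covers (uphalf k).-1 (left_side k k./2.-1).
  rewrite /left_side; case: eqP => [|_]; first by lia.
  by rewrite eqxx; apply: IHk; lia.
have coversC : covers (uphalf k) (xi d (uphalf k)) by apply: IHk; lia.
rewrite /stem /spine_height; case: eqP => n0.
  have := stem_covers_binary k4 c0 coversL coversR coversLp coversC; rewrite subn0.
  apply=> // i lt_i; [rewrite /left_side | rewrite /right_side];
    by do 2?[case: ifP => _]; apply: is_empty_xi; lia.
have q_eq : k.+1 %/ 4 = (uphalf k)./2 by lia.
apply: covers_trans (collapse _ (is_empty_column _ _ _ _ c0)) _.
have := @column_covers n k _ _ _ k4 c0 coversL coversR coversLp coversC 0.
rewrite !subn0; apply=> //.
- by rewrite /left_side eqxx q_eq; apply: IHk; lia.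
- by rewrite /right_side eqxx q_eq; apply: IHk; lia.
Qed.

Lemma M_stem k : 4 <= k ->
  M d k = d + \sum_(1 <= i < (spine_height k).+1)
    ((3 * n).+2 + nverts (left_side k i) + nverts (right_side k i)) + M d (uphalf k).
Proof.
by move=> k4; rewrite /M xi_stem // nverts_grow nverts_column size_enum_ord addnA add1n.
Qed.

End Gluing.

(** * Bounds on the size of xi *)

Section Size.
Variable n : nat.
Local Notation d := n.+2.

Lemma M_gt0 k : 0 < k -> 0 < M d k.
Proof. by move=> k0; rewrite lt0n nverts_eq0 is_empty_xi. Qed.

Lemma M1 : M d 1 = 1.
Proof. exact: nverts_leaf. Qed.

Lemma M2 : M d 2 = n.+3.
Proof.
by rewrite /M xiE /xi_step crescentE nverts_grow size_enum_ord nverts_leaf addn1.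
Qed.

Lemma M3 : M d 3 = d + n.+3.
Proof.
rewrite /M xiE /xi_step crescentE -[X in glue _ X]cats0 glue_grow glue_leaf //.
rewrite nverts_grow size_enum_ord /= (eq_bigr (fun=> 1)).
  by rewrite sum_nat_const card_ord muln1.
by move=> i _; rewrite ffunE -/(leaf d) nverts_leaf.
Qed.

(** The spine has at most [k./2] vertebrae. Each one adds fewer than [3 * d]
    vertices of its own and two trees of size at most [F]. *)
Lemma M_le_step k F : 4 <= k -> 0 < F ->
  (forall i, 0 < i <= uphalf k -> M d i <= F) -> M d k <= (3 * d) * k * F.
Proof.
move=> k4 F0 MF; rewrite M_stem //.
have MFc : M d (uphalf k) <= F by apply: MF; lia.
have h_le : spine_height n k <= k./2 by rewrite /spine_height; case: ifP => _; lia.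
have sum_le : \sum_(1 <= i < (spine_height n k).+1)
    ((3 * n).+2 + nverts (left_side n k i) + nverts (right_side n k i)) <=
    k./2 * (3 * d * F).
  apply: (@leq_trans (\sum_(1 <= i < (spine_height n k).+1) (3 * d * F))).
    rewrite !big_nat; apply: leq_sum => i lt_i.
    have L : nverts (left_side n k i) <= F.
      by rewrite /left_side; do 2?[case: ifP => _]; apply: MF; lia.
    have R : nverts (right_side n k i) <= F.
      by rewrite /right_side; case: ifP => _; apply: MF; lia.
    nia.
  by rewrite sum_nat_const_nat subn1 leq_mul2r h_le orbT.
apply: leq_trans (leq_add (leq_add (leqnn d) sum_le) MFc) _.
have le_dF : d + F <= 3 * d * F by nia.
apply: (@leq_trans (k./2.+1 * (3 * d * F))); first by rewrite mulSn; lia.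
by rewrite (mulnAC _ k F) [leqRHS]mulnC leq_mul //; lia.
Qed.

(** Iterate [M_le_step]: each halving of [k] costs a factor [3 * d * 2 ^ L], and
    the exponents of 2 add up to a binomial coefficient. *)
Lemma M_upper L k : 0 < k <= 2 ^ L -> M d k <= (3 * d) ^ L.+1 * 2 ^ 'C(L.+1, 2).
Proof.
elim: L k => [|L IHL] k; first by move=> k1; rewrite (_ : k = 1) ?M1; lia.
move=> /andP[k0 le_k]; have G0 : 0 < (3 * d) ^ L.+1 * 2 ^ 'C(L.+1, 2).
  by rewrite muln_gt0 !expn_gt0.
have [k4|k3] := leqP 4 k; last first.
  apply: (@leq_trans (3 * d)); last first.
    by rewrite expnS -mulnA leq_pmulr // muln_gt0 !expn_gt0.
  by case: k k0 k3 {le_k} => [|[|[|[|k]]]] // _ _; rewrite ?M1 ?M2 ?M3; lia.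
apply: leq_trans (M_le_step k4 G0 _) _.
  by move=> i le_i; apply: IHL; rewrite expnS in le_k; lia.
rewrite mulnACA -expnS (binS L.+1) bin1 expnD leq_mul2l (mulnC k) leq_mul2l.
by rewrite le_k !orbT.
Qed.

(** The right side trees of the vertebrae 1, ..., [k./2.-1] account for the sizes
    up to [k./2.-1]. The bottom tree has size [M d (uphalf k)] and, if [k] is odd,
    the special left tree of vertebra [k./2.-1] is the copy for the remaining
    argument [k./2]. *)
Lemma M_ge_sum k : 4 <= k -> \sum_(1 <= i < (uphalf k).+1) M d i <= M d k.
Proof.
move=> k4; rewrite M_stem // big_nat_recr /=; last by lia.
rewrite leq_add2r; apply: leq_trans _ (leq_addl _ _).
have h_ge : k./2.-1 <= spine_height n k by rewrite /spine_height; case: ifP => _; lia.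
rewrite [leqRHS](big_cat_nat (n := k./2)) /=; try lia.
apply: leq_trans _ (leq_addr _ _).
have [p def_p] : exists p, k./2 = p.+2 by exists (k./2 - 2); lia.
have sides i : 0 < i < p.+1 -> nverts (left_side n k i) = M d i /\ 
    nverts (right_side n k i) = M d i.
  by move=> lt_i; rewrite /left_side /right_side !ifF //; lia.
rewrite def_p big_nat_recr //= [left_side _ _ _]/left_side def_p ifF; last by lia.
rewrite /= eqxx [right_side _ _ _]/right_side def_p ifF; last by lia.
rewrite -/(M d _) -/(M d _).
have le_p : \sum_(1 <= i < p.+1) M d i <= \sum_(1 <= i < p.+1)
   ((3 * n).+2 + nverts (left_side n k i) + nverts (right_side n k i)).
  rewrite !big_nat; apply: leq_sum => i lt_i.
  by have [-> _] := sides i lt_i; lia.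
have [c_odd|c_even] : uphalf k = p.+3 \/ uphalf k = p.+2 by lia.
  rewrite c_odd big_nat_recr //= big_nat_recr //=; lia.
by rewrite c_even big_nat_recr //=; lia.
Qed.

(** A discrete form of the integral of x^m, by telescoping. *)
Lemma pow_sum_ge m c : c ^ m.+1 <= m.+1 * \sum_(1 <= i < c.+1) i ^ m.
Proof.
have step a : a.+1 ^ m.+1 <= a ^ m.+1 + m.+1 * a.+1 ^ m.
  elim: m => [|m IHm]; first by rewrite !expn1 expn0; lia.
  rewrite expnS; apply: leq_trans (leq_mul (leqnn _) IHm) _.
  have le_a : a ^ m.+1 <= a.+1 ^ m.+1 by rewrite leq_exp2r.
  rewrite mulnDr mulnCA -expnS mulSn -expnS -addnA addnCA leq_add2l mulSn.
  by rewrite leq_add2r.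
elim: c => [|c IHc]; first by rewrite exp0n.
rewrite big_nat_recr //= mulnDr; apply: leq_trans (step c) _.
by rewrite leq_add2r.
Qed.

(** The polynomial lower bound of degree [m] improves to degree [m.+1] when it
    is summed: this costs a factor [m.+1] for the sum of powers and [2 ^ m.+1]
    since the sum only extends to half of [k]. *)
Lemma M_lower m k : 0 < k -> k ^ m <= M d k * (m`! * 2 ^ 'C(m.+1, 2)).
Proof.
elim: m k => [|m IHm] k k0; first by rewrite expn0 !muln1 M_gt0.
have D0 : 0 < m.+1`! by apply: fact_gt0.
have [k4|k3] := leqP 4 k; last first.
  rewrite bin2 /=; have le_D : 2 ^ (m.+2 * m.+1)./2 <= m.+1`! * 2 ^ (m.+2 * m.+1)./2.
    by rewrite leq_pmull.
  case: k k0 k3 => [|[|[|[|k]]]] // _ _; rewrite ?M1 ?M2 ?M3.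
  - by rewrite exp1n mul1n muln_gt0 D0 expn_gt0.
  - apply: leq_trans _ (leq_pmull _ _) => //; apply: leq_trans _ le_D.
    by rewrite leq_exp2l //; nia.
  - apply: leq_trans _ (leq_mul (m1 := 4) _ le_D); last by lia.
    apply: (@leq_trans (4 ^ m.+1)); first by rewrite leq_exp2r.
    by rewrite -[4]/(2 ^ 2) -expnM -expnD leq_exp2l //; nia.
have pow_le : k ^ m.+1 <= 2 ^ m.+1 * uphalf k ^ m.+1.
  by rewrite -expnMn leq_exp2r //; lia.
apply: leq_trans pow_le _; rewrite (binS m.+1) bin1 expnD factS.
apply: (@leq_trans (2 ^ m.+1 * (m.+1 * \sum_(1 <= i < (uphalf k).+1) i ^ m))).
  by rewrite leq_mul2l pow_sum_ge orbT.
apply: (@leq_trans (2 ^ m.+1 * (m.+1 * (M d k * (m`! * 2 ^ 'C(m.+1, 2)))))).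
  rewrite !leq_mul2l; apply/orP; right; apply/orP; right.
  apply: leq_trans _ (leq_mul (M_ge_sum k4) (leqnn _)).
  rewrite big_distrl /= !big_nat; apply: leq_sum => i lt_i; apply: IHm; lia.
by rewrite eq_leq //; lia.
Qed.
End Size.

(** * Growth rate *)

Local Open Scope classical_set_scope.
Local Open Scope ring_scope.

Section Growth.
Variables (R : realType) (n : nat).
Local Notation d := n.+2.
Local Notation lam := (ln 2 : R).

Lemma ln2_gt0 : 0 < lam.
Proof. by apply: ln_gt0; lra. Qed.

Lemma lnX_nat (a b : nat) : (0 < a)%N -> ln (a ^ b)%:R = b%:R * ln a%:R :> R.
Proof. by move=> a0; rewrite natrX lnXn ?ltr0n // mulr_natl. Qed.

Lemma ler_ln_nat (a b : nat) : (0 < a <= b)%N -> ln a%:R <= ln b%:R :> R.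
Proof. by case/andP=> a0 ab; rewrite ler_ln ?posrE ?ler_nat ?ltr0n //; lia. Qed.

Lemma bin2R (m : nat) : ('C(m.+1, 2))%:R = m%:R * (m%:R + 1) / 2 :> R.
Proof.
have := bin2 m.+1; rewrite /= => ->; have := odd_double_half (m.+1 * m)%N.
rewrite oddM /= andNb add0n -muln2 => /(congr1 (fun x => x%:R : R)).
by rewrite !natrM -[m.+1%:R]natr1; lra.
Qed.

Lemma ln_le_sqrt (x : R) : 0 < x -> ln x <= 2 * Num.sqrt x.
Proof.
move=> x0; have s0 : 0 < Num.sqrt x by rewrite sqrtr_gt0.
rewrite -{1}(sqr_sqrtr (ltW x0)) lnXn // -mulr_natl.
by have := ln_sublinear s0; lra.
Qed.

Lemma ln_fact_le m : (0 < m)%N -> ln (m`!)%:R <= m%:R * (2 * Num.sqrt m%:R) :> R.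
Proof.
move=> m0; apply: (@le_trans _ _ (ln (m ^ m)%:R)).
  apply: ler_ln_nat; rewrite fact_gt0 /=.
  rewrite fact_prod; apply: (@leq_trans (\prod_(1 <= i < m.+1) m)%N).
    by rewrite !big_nat; apply: leq_prod => i; rewrite ltnS => /andP[].
  by rewrite prod_nat_const_nat subn1.
by rewrite lnX_nat // ler_wpM2l // ln_le_sqrt // ltr0n.
Qed.

Lemma ln_M_upper (k m : nat) : (0 < k <= 2 ^ m)%N ->
  ln (M d k)%:R <= (m%:R + 1) * ln (3 * d)%:R + m%:R * (m%:R + 1) / 2 * lam :> R.
Proof.
move=> le_k; have k0 : (0 < k)%N by lia.
apply: (@le_trans _ _ (ln ((3 * d) ^ m.+1 * 2 ^ 'C(m.+1, 2))%:R)).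
  by apply: ler_ln_nat; rewrite M_gt0 ?M_upper.
rewrite natrM lnM ?posrE ?ltr0n ?expn_gt0 // !lnX_nat // bin2R -natr1.
exact: lexx.
Qed.

Lemma ln_M_lower (k m : nat) : (0 < k)%N -> (0 < m)%N ->
  m%:R * ln k%:R <= ln (M d k)%:R + m%:R * (2 * Num.sqrt m%:R)
    + m%:R * (m%:R + 1) / 2 * lam :> R.
Proof.
move=> k0 m0; have M0 := M_gt0 n k0.
rewrite -lnX_nat //.
apply: le_trans (ler_ln_nat (b := M d k * (m`! * 2 ^ 'C(m.+1, 2)))%N _) _.
  by rewrite expn_gt0 k0 M_lower.
rewrite !natrM lnM ?posrE ?mulr_gt0 ?ltr0n ?fact_gt0 ?expn_gt0 //.
rewrite lnM ?posrE ?ltr0n ?fact_gt0 ?expn_gt0 // lnX_nat // bin2R.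
by have := ln_fact_le m0; lra.
Qed.

Definition rel_error (k : nat) : R :=
  2 * lam * ln (M d k)%:R / ln k%:R ^+ 2 - 1.

Lemma M_powR k : (0 < k)%N ->
  (M d k)%:R = k%:R `^ (2^-1 * (ln (k%:R : R) / ln 2) * (1 + rel_error k)).
Proof.
move=> k0; have M0 : (0 : R) < (M d k)%:R by rewrite ltr0n M_gt0.
rewrite /powR pnatr_eq0 gtn_eqF //; have l0 := ln2_gt0.
have [->|k1] := eqVneq k 1; first by rewrite M1 ln1 mulr0 expR0.
have x0 : 0 < ln (k%:R : R) by apply: ln_gt0; rewrite ltr1n; lia.
rewrite -[LHS]lnK ?posrE // /rel_error; congr expR; field.
by rewrite !gt_eqF.
Qed.

(** Write s for the square root of m, x for ln k, y for ln (M d k) and l for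
    ln 2, so that s^2 l <= x <= (s^2 + 1) l. After division by x^2, which is at
    least s^4 l^2, the terms of the upper bound on 2 l y other than s^4 l^2
    contribute O(1/s^2). In the lower bound the dominant error, of order s^3,
    comes from ln (m!) <= 2 s^3. *)
Lemma rel_error_bound : exists2 K : R, 0 < K & forall k m : nat,
  (0 < m)%N -> (2 ^ m <= k < 2 ^ m.+1)%N ->
  `|rel_error k| <= K / Num.sqrt m%:R.
Proof.
have l0 := ln2_gt0; set l := ln 2 in l0 *.
have K0 : 0 < ln (3 * d)%:R :> R by apply: ln_gt0; rewrite ltr1n.
set a := ln (3 * d)%:R in K0 *.
exists (5 + 6 * a / l + 4 + 4 / l); first by rewrite !addr_gt0 ?divr_gt0 ?mulr_gt0.
move=> k m m0 /andP[le_k lt_k]; have k0 : (0 < k)%N by rewrite (leq_trans _ le_k) ?expn_gt0.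
set s := Num.sqrt (m%:R : R).
have s2 : s ^+ 2 = m%:R by rewrite sqr_sqrtr.
have s1 : 1 <= s by rewrite -[1]sqrtr1 ler_sqrt ?ler1n.
have up : ln (M d k)%:R <= (s ^+ 2 + 2) * a + (s ^+ 2 + 1) * (s ^+ 2 + 2) / 2 * l.
  have := @ln_M_upper k m.+1; rewrite -natr1 -s2 k0 (ltnW lt_k) => /(_ isT).
  by rewrite -/a -/l; lra.
have lo := ln_M_lower k0 m0.
have x_lo : s ^+ 2 * l <= ln k%:R.
  by rewrite s2 /l -(lnX_nat _ (isT : (0 < 2)%N)); apply: ler_ln_nat; rewrite expn_gt0.
have x_up : ln k%:R <= (s ^+ 2 + 1) * l.
  by rewrite s2 natr1 /l -(lnX_nat _ (isT : (0 < 2)%N)); apply: ler_ln_nat; rewrite k0 ltnW.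
have y0 : 0 <= ln (M d k)%:R :> R by apply: ln_ge0; rewrite ler1n M_gt0.
rewrite -/s -s2 -/l in lo.
rewrite /rel_error -/l.
move: lo up x_lo x_up y0; set x := ln k%:R; set y := ln (M d k)%:R => lo up x_lo x_up y0.
have s0 : 0 < s := lt_le_trans ltr01 s1.
have S1 : 1 <= s ^+ 2 by rewrite exprn_ege1.
have x0 : 0 < x by apply: lt_le_trans x_lo; rewrite mulr_gt0 ?exprn_gt0.
have li0 : 0 < l^-1 by rewrite invr_gt0.
have ali0 : 0 < a / l by rewrite divr_gt0.
have al0 := mulr_gt0 K0 l0; have ll0 := mulr_gt0 l0 l0.
rewrite ler_norml; apply/andP; split; last first.
  rewrite lerBlDl ler_pdivrMr ?exprn_gt0 //.
  apply: (@le_trans _ _ ((1 + (5 + 6 * a / l) / s ^+ 2) * (s ^+ 2 * l) ^+ 2)).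
    have -> : (1 + (5 + 6 * a / l) / s ^+ 2) * (s ^+ 2 * l) ^+ 2 =
        (s ^+ 2 * l) ^+ 2 + (5 * (l * l) + 6 * (a * l)) * s ^+ 2.
      by field; rewrite !gt_eqF.
    have := ler_wpM2l (ltW l0) up.
    have := mulr_ge0 (ltW al0) (_ : 0 <= s ^+ 2 - 1).
    have := mulr_ge0 (ltW ll0) (_ : 0 <= s ^+ 2 - 1).
    rewrite subr_ge0 => /(_ S1) h1 /(_ S1) h2; set S := s ^+ 2 in h1 h2 *; lra.
  apply: ler_pM; rewrite ?sqr_ge0 //.
  - by rewrite addr_ge0 ?divr_ge0 ?addr_ge0 ?mulr_ge0 ?invr_ge0 ?ltW // exprn_gt0.
  - rewrite lerD2l; apply: ler_pM.
    + by rewrite addr_ge0 ?divr_ge0 ?mulr_ge0 ?ltW.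
    + by rewrite invr_ge0 sqr_ge0.
    + lra.
    + by rewrite lef_pV2 ?posrE ?exprn_gt0 // expr2 ler_peMr // ltW.
  - by rewrite ler_sqr ?nnegrE // ltW // mulr_gt0 ?exprn_gt0.
rewrite lerBrDl.
apply: (@le_trans _ _ (1 - (4 + 4 / l) / s)).
  rewrite -mulNr lerD2l mulNr lerN2 ler_wpM2r ?invr_ge0 ?ltW //.
  lra.
(* If 1 - (4 + 4/l)/s is negative, then y >= 0 suffices; otherwise x may be
   replaced by its upper bound. *)
have [neg|pos] := lerP (1 - (4 + 4 / l) / s) 0.
  by apply: le_trans neg _; rewrite divr_ge0 ?sqr_ge0 // mulr_ge0 // mulr_ge0 // ltW.
rewrite ler_pdivlMr ?exprn_gt0 //.
apply: (@le_trans _ _ ((1 - (4 + 4 / l) / s) * ((s ^+ 2 + 1) * l) ^+ 2)).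
  apply: ler_wpM2l; first exact: ltW.
  by rewrite ler_sqr ?nnegrE // ltW // (lt_le_trans x0).
have y_lo : (s ^+ 4 - s ^+ 2) * (l * l) - 4 * s ^+ 3 * l <= 2 * l * y.
  have := ler_wpM2l (ltW l0) (ler_wpM2l (sqr_ge0 s) x_lo).
  have := ler_wpM2l (ltW l0) lo; lra.
apply: le_trans y_lo; pose Q := (s ^+ 2 + 1) ^+ 2 / s.
have -> : (1 - (4 + 4 / l) / s) * ((s ^+ 2 + 1) * l) ^+ 2 =
    (s ^+ 2 + 1) ^+ 2 * (l * l) - 4 * (l * l) * Q - 4 * l * Q.
  by rewrite /Q; field; rewrite !gt_eqF.
have Q_ge : s ^+ 3 <= Q.
  rewrite ler_pdivlMr // -exprSr -[4%N]/(2 * 2)%N exprM.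
  by rewrite ler_sqr ?nnegrE ?addr_ge0 ?sqr_ge0 // lerDl.
have s3 : s ^+ 2 <= s ^+ 3 by rewrite [leRHS]exprS ler_peMl ?sqr_ge0.
have := ler_wpM2l (ltW ll0) Q_ge; have := ler_wpM2l (ltW l0) Q_ge.
have := ler_wpM2l (ltW ll0) s3; have := ler_wpM2l (ltW ll0) S1; lra.
Qed.

Lemma rel_error_cvg0 : rel_error k @[k --> \oo] --> (0 : R).
Proof.
have [K K0 bound] := rel_error_bound; apply/cvgrPdist_le => e e0.
pose N := Num.bound ((K / e) ^+ 2).
exists (2 ^ N.+1)%N => // k /= le_k.
rewrite sub0r normrN; pose m := trunc_log 2 k.
have k0 : (0 < k)%N by rewrite (leq_trans _ le_k) ?expn_gt0.
have lt_Nm : (N < m)%N by rewrite /m trunc_log_max.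
apply: le_trans (bound k m _ _) _; [lia | exact: trunc_log_bounds | ].
have s0 : 0 < Num.sqrt m%:R :> R by rewrite sqrtr_gt0 ltr0n; lia.
rewrite ler_pdivrMr // mulrC -ler_pdivrMr //.
rewrite -[K / e]ger0_norm; last by rewrite divr_ge0 ?ltW.
rewrite -sqrtr_sqr; apply: ler_wsqrtr.
apply: ltW; apply: lt_le_trans (archi_boundP _) _; first by rewrite sqr_ge0.
by rewrite ler_nat ltnW.
Qed.
End Growth.

Theorem corollary2p7 (R : realType) (d : nat) (hd : (2 <= d)%N) :
  (forall k : nat, (1 <= k)%N ->
     exists2 n : nat, is_Nnon d k n & (n <= M d k)%N) /\
  (exists2 eps : nat -> R, eps n @[n --> \oo] --> (0 : R) &
     forall k : nat, (1 <= k)%N ->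
       (M d k)%:R =
       k%:R `^ (2^-1 * (ln (k%:R : R) / ln 2) * (1 + eps k))).
Proof.
case: d hd => [|[|n]] // _; split=> [k k0|]; last first.
  exists (rel_error R n); first exact: rel_error_cvg0.
  by move=> k k0; apply: M_powR.
have univ : universal k (xi n.+2 k).
  by move=> T szT; apply: xi_covers => //; rewrite szT k0 leqnn.
pose P m := `[< exists2 U : dtree n.+2, universal k U & nverts U = m >].
have exP : exists m, P m by exists (M n.+2 k); apply/asboolP; exists (xi n.+2 k).
have [m /asboolP mP m_min] := ex_minnP exP.
exists m; last by apply: m_min; apply/asboolP; exists (xi n.+2 k).
by split=> // U uU; apply: m_min; apply/asboolP; exists U.
Qed.
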